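(* Let $\mathcal{C}$ be a $\sigma$-algebra of subsets of a nonempty set $\Omega$ and let $\mu:\mathcal{C}\to[0,1]$ be a capacity. Let $f:[0,1]\times\Omega\to\mathbb{R}$ be a random function which is continuous at each $x\in[0,1]$, uniformly with respect to $\omega\in\Omega$. Let $Y=\{Y_{n,k}:n\in\mathbb{N},\ k=0,\dots,n\}$ be a triangular array of random variables on $(\Omega,\mathcal{C})$ such that $0\le Y_{n,0}\le Y_{n,1}\le\dots\le Y_{n,n}\le 1$, and set $$M_{n}(\omega)=\max\left\{\left|Y_{n,k}(\omega)-\frac{k}{n}\right|:0\le k\le n\right\},\qquad B_{n}(f,Y)(x,\omega)=\sum_{k=0}^{n}f(Y_{n,k}(\omega),\omega)\,p_{k,n}(x).$$ If $\lim_{n\to\infty}\mu(\{\omega\in\Omega:M_{n}(\omega)>\varepsilon\})=0$ for every $\varepsilon>0$, then $B_{n}(f,Y)(x,\omega)$ converges to $f(x,\omega)$ in capacity, uniformly with respect to $x\in[0,1]$. In addition, for every $0<\delta<1$ and every $n\ge 1/\delta^{2}$, $$\mu\left(\left\{\omega\in\Omega:\sup_{x\in[0,1]}|B_{n}(f,Y)(x,\omega)-f(x,\omega)|>(1+c)K(f;\delta)\right\}\right)\le\mu(\{\omega\in\Omega:M_{n}(\omega)>\delta\}),$$ where $c=\frac{4306+837\sqrt{6}}{5832}$ is the Sikkema constant.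
   Context: $\mathbb{N}$ denotes the positive integers and $p_{k,n}(x)=\binom{n}{k}x^{k}(1-x)^{n-k}$. A capacity on $(\Omega,\mathcal{C})$ is a set function $\mu$ with $\mu(\emptyset)=0$, $\mu(\Omega)=1$ and $\mu(A)\le\mu(B)$ whenever $A\subset B$, $A,B\in\mathcal{C}$ (no additivity is assumed). Random variables are $\mathcal{C}$-measurable real functions on $\Omega$. That $f$ is a random function means that $f(x,\cdot)$ is a random variable for each $x\in[0,1]$. ''Continuous at each $x\in[0,1]$, uniformly with respect to $\omega$'' means: for every $x\in[0,1]$ and $\varepsilon>0$ there is $\delta>0$ such that $|f(y,\omega)-f(x,\omega)|<\varepsilon$ for all $\omega\in\Omega$ and all $y\in[0,1]$ with $|y-x|<\delta$. For $\delta\ge 0$, $$K(f;\delta)=\sup_{\omega\in\Omega}\ \sup\{|f(x,\omega)-f(y,\omega)|:x,y\in[0,1],\ |x-y|\le\delta\}.$$ $B_{n}(f,Y)$ converges to $f$ in capacity uniformly with respect to $x\in[0,1]$ if for all $\varepsilon,\eta>0$ there is $n_{0}$ such that $\mu(\{\omega\in\Omega:|B_{n}(f,Y)(x,\omega)-f(x,\omega)|\ge\varepsilon\})<\eta$ for all $n\ge n_{0}$ and all $x\in[0,1]$. *)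

(* Defs.v *)
From mathcomp Require Import all_boot all_order all_algebra.
From mathcomp Require Import all_classical all_reals all_analysis.
Import Order.TTheory GRing.Theory Num.Theory.
Import numFieldNormedType.Exports.

Set Implicit Arguments.
Unset Strict Implicit.
Unset Printing Implicit Defensive.

Local Open Scope classical_set_scope.
Local Open Scope ring_scope.

(* Only the restriction of [mu] to the measurable sets is constrained: the
   values of [mu] on other sets are arbitrary. *)
Record capacity d (T : measurableType d) (R : realType) (mu : set T -> R) :
    Prop := Capacity {
  capacity_set0 : mu set0 = 0 ;
  capacity_setT : mu setT = 1 ;
  le_capacity : forall A B : set T,
    measurable A -> measurable B -> A `<=` B -> mu A <= mu B }.

(* A function on [0, 1] * T is represented by [f : R -> T -> R], of which only
   the values [f x w] with [x] in [0, 1] are used. *)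
Definition random_function d (T : measurableType d) (R : realType)
    (f : R -> T -> R) : Prop :=
  forall x, x \in `[0, 1] -> measurable_fun [set: T] (f x).

Definition continuous01_unif (T : Type) (R : realType) (f : R -> T -> R) :
    Prop :=
  forall x, x \in `[0, 1] -> forall eps, 0 < eps ->
    exists2 delta, 0 < delta &
      forall (w : T) y, y \in `[0, 1] -> `|y - x| < delta ->
        `|f y w - f x w| < eps.

(* The entry [Y n k] is meaningful only for [0 < n] and [k <= n]. *)
Record random_array d (T : measurableType d) (R : realType)
    (Y : nat -> nat -> T -> R) : Prop := RandomArray {
  random_array_measurable : forall n k, (0 < n)%N -> (k <= n)%N ->
    measurable_fun [set: T] (Y n k) ;
  random_array_ge0 : forall n w, (0 < n)%N -> 0 <= Y n 0%N w ;
  random_array_nondecreasing : forall n k w, (0 < n)%N -> (k < n)%N ->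
    Y n k w <= Y n k.+1 w ;
  random_array_le1 : forall n w, (0 < n)%N -> Y n n w <= 1 }.

Definition bernstein_basis (R : realType) (k n : nat) (x : R) : R :=
  'C(n, k)%:R * x ^+ k * (1 - x) ^+ (n - k).

(* The initial value 0 does not affect the maximum of nonnegative numbers. *)
Definition max_dev (T : Type) (R : realType) (Y : nat -> nat -> T -> R)
    (n : nat) (w : T) : R :=
  \big[Num.max/0]_(k < n.+1) `|Y n k w - k%:R / n%:R|.

Definition bernstein (T : Type) (R : realType) (f : R -> T -> R)
    (Y : nat -> nat -> T -> R) (n : nat) (x : R) (w : T) : R :=
  \sum_(k < n.+1) f (Y n k w) w * bernstein_basis k n x.

Definition modulus (T : Type) (R : realType) (f : R -> T -> R) (delta : R) :
    \bar R :=
  ereal_sup [set ereal_sup [set (`|f xy.1 w - f xy.2 w|)%:E | xy in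
      [set xy : R * R | [/\ xy.1 \in `[0, 1], xy.2 \in `[0, 1] &
                            `|xy.1 - xy.2| <= delta]]] | w in [set: T]].

Definition sup_dist01 (R : realType) (g h : R -> R) : \bar R :=
  ereal_sup [set (`|g x - h x|)%:E | x in `[0, 1]].

Definition cvg_in_capacity_unif01 (T : Type) (R : realType) (mu : set T -> R)
    (g : nat -> R -> T -> R) (f : R -> T -> R) : Prop :=
  forall eps eta, 0 < eps -> 0 < eta ->
    exists2 n0, (0 < n0)%N &
      forall n x, (n0 <= n)%N -> x \in `[0, 1] ->
        mu [set w | eps <= `|g n x w - f x w|] < eta.

Definition sikkema (R : realType) : R :=
  (4306 + 837 * Num.sqrt 6) / 5832.

(* Main.v *)
Require Import Defs.
From mathcomp Require Import all_boot all_order all_algebra.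
From mathcomp Require Import all_classical all_reals all_analysis.
From mathcomp Require Import ring lra zify measurable_realfun.
Import Order.TTheory GRing.Theory Num.Theory.
Import numFieldNormedType.Exports.

Set Implicit Arguments.
Unset Strict Implicit.
Unset Printing Implicit Defensive.

Local Open Scope classical_set_scope.
Local Open Scope ring_scope.

(** The second claim is an inclusion of events, and the whole difficulty is an
estimate for one outcome w. Write g = f(., w) and let K be the modulus K(f; delta).
If |u - v| <= N * delta for an integer N, then |g u - g v| <= N * K, so it suffices to
count the steps of length delta that lead from x to Y_{n,k}. When M_n(w) <= delta,
the point Y_{n,k} is within delta of k/n; two steps are enough as long as k/n is
within d = 1 / sqrt n <= delta of x, and some extra steps are needed beyond. Hence
|B_n - f| <= (2 + E) * K, where E is the mean of the number of extra steps under the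
binomial weights, and everything reduces to E <= c - 1 = 0.08988... .

For the classical Bernstein polynomials the same count gives Sikkema's theorem,
where the constant c is approached for n = 6, so a proof along these lines
would have no slack. Here there is some: the points Y_{n,k} stay in [0, 1], so an
extra step to the right is needed only if 1 - x > 2 * d, an extra step to the left only
if x > 2 * d, and a second extra step only with 3 * d in place of 2 * d. In particular
n >= 5 as soon as some extra step is possible, n >= 17 when both directions occur,
and n > 25 when moreover a second step does. So it suffices to bound each side by
(c - 1) / 2 if n >= 17, and one side alone by c - 1 if n >= 5, and a uniform bound of
the binomial tail beyond sqrt n does both (overshoot_mean_pair_le).

Let k be the first index with k / n > x + d. The ratios of consecutive binomial weights
decrease, so the tail is at most p_{k,n}(x) / (1 - r), where r is the ratio at k
(bernstein_basis_geometric); the second and later extra steps multiply this by at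
most 9/8, because r ^ floor(sqrt n) <= 1/9 (odds_ratio_expn_le). The weight
p_{k,n}(x) itself is bounded by Stirling's formula and by Pinsker's inequality
(bernstein_basis_sqr_le). The product is e ^ (-35/12) times an explicit algebraic
function of x and d (bernstein_tail_sqr_le), and polynomial inequalities in these
two variables conclude.

For the capacities only monotonicity is available, and only on measurable sets. Hence
the measurability of the two events has to be shown: w |-> f(Y(w), w) is a pointwise
limit of discretizations, and by continuity the supremum over x may be
restricted to rational x. The first claim follows from the estimate for one outcome, with
delta chosen by a Heine argument so that K(f; delta) is small. *)

(** * Logarithmic inequalities and Stirling's formula *)

Section Calculus.
Context {R : realType}.
Implicit Types (x t : R).

Lemma ge0_is_derive_le (f df : R -> R) (a b : R) :
  (forall x, x \in `[a, b] -> is_derive x 1 f (df x)) ->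
  (forall x, x \in `]a, b[ -> 0 <= df x) -> a <= b -> f a <= f b.
Proof.
move=> fdf df0; rewrite le_eqVlt => /predU1P[->//|ab].
have sub x : x \in `]a, b[ -> x \in `[a, b] by exact: subset_itv_oo_cc.
have cf : {within `[a, b], continuous f}.
  apply: derivable_within_continuous => x /fdf fx.
  exact: ex_derive.
have [c cab e] := MVT ab (fun x xab => fdf x (sub x xab)) cf.
by rewrite -subr_ge0 e mulr_ge0 ?df0// subr_ge0 ltW.
Qed.

Lemma is_derive_ln1D t : -1 < t -> is_derive t 1 (fun u : R => ln (1 + u)) (1 + t)^-1.
Proof.
move=> t1; have t0 : 0 < 1 + t by lra.
rewrite -[X in is_derive _ _ _ X]mulr1.
apply: (@is_derive1_comp R (@ln R) (fun u : R => 1 + u)).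
  exact: is_derive1_ln.
by apply: is_derive_eq; ring.
Qed.

Lemma is_derive_ln1B t : t < 1 -> is_derive t 1 (fun u : R => ln (1 - u)) (- (1 - t)^-1).
Proof.
move=> t1; have t0 : 0 < 1 - t by lra.
rewrite -mulrN1.
apply: (@is_derive1_comp R (@ln R) (fun u : R => 1 - u)).
  exact: is_derive1_ln.
by apply: is_derive_eq; ring.
Qed.

(** The two bounds of ln ((1 + t) / (1 - t)) are the first term of its power series and the
series with the coefficients 2/5, 2/7, ... all raised to 2/3. At t = 1 / (2 n + 1) they
control the increments of Stirling's sequence. *)
Lemma ln_ratio_ge t : 0 <= t < 1 -> 2 * t <= ln (1 + t) - ln (1 - t).
Proof.
move=> /andP[t0 t1].
pose f u : R := ln (1 + u) - ln (1 - u) - 2 * u.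
suff : f 0 <= f t by rewrite /f addr0 subr0 subrr mulr0 subr0; lra.
apply: (@ge0_is_derive_le f (fun u => (1 + u)^-1 + (1 - u)^-1 - 2)) => //.
  move=> u; rewrite in_itv/= => /andP[u0 ut].
  have := @is_derive_ln1D u ltac:(lra).
  have := @is_derive_ln1B u ltac:(lra) => d1 d2.
  by apply: is_derive_eq; rewrite opprK /GRing.scale/=; ring.
move=> u; rewrite in_itv/= => /andP[u0 ut].
have -> : (1 + u)^-1 + (1 - u)^-1 - 2 = 2 * u ^+ 2 / ((1 + u) * (1 - u)).
  by field; apply/andP; split; apply: lt0r_neq0; lra.
by rewrite divr_ge0 ?mulr_ge0 ?sqr_ge0//; lra.
Qed.

Lemma ln_ratio_le t : 0 <= t < 1 ->
  ln (1 + t) - ln (1 - t) <= 2 * t + 2 / 3 * t ^+ 3 / (1 - t ^+ 2).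
Proof.
move=> /andP[t0 t1].
pose f u : R := 2 * u + 2 / 3 * (u * (u ^+ 2 * (1 - u ^+ 2)^-1)) - (ln (1 + u) - ln (1 - u)).
suff : f 0 <= f t.
  rewrite /f addr0 subr0 subrr mulr0 subr0 mul0r mulr0 add0r subr_ge0 => /le_trans; apply.
  by rewrite lerD2l -!mulrA ler_wpM2l // exprS !mulrA mulrC -!mulrA.
pose df (u : R) := 4 / 3 * u ^+ 4 / (1 - u ^+ 2) ^+ 2.
apply: (@ge0_is_derive_le f df 0 t _ _ t0).
  move=> u; rewrite in_itv/= => /andP[u0 ut].
  have := @is_derive_ln1D u ltac:(lra).
  have := @is_derive_ln1B u ltac:(lra) => d1 d2.
  have u2 : 1 - u ^+ 2 != 0 by apply: lt0r_neq0; nra.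
  have d3 : is_derive u 1 (fun v : R => (1 - v ^+ 2)^-1)
      (- (1 - u ^+ 2) ^- 2 *: (- (2 * u))).
    apply: is_deriveV => //.
    by apply: is_derive_eq; rewrite /GRing.scale/=; ring.
  apply: is_derive_eq; rewrite /df /GRing.scale/=.
  by field; rewrite u2/=; apply/andP; split; apply: lt0r_neq0; lra.
move=> u; rewrite in_itv/= => /andP[u0 ut].
by rewrite /df mulr_ge0 ?invr_ge0 ?sqr_ge0// mulr_ge0 ?exprn_ge0//; lra.
Qed.
End Calculus.

Section Stirling.
Context {R : realType}.

(** The logarithm of n! / (n ^ (n + 1/2) * e ^ (- n)), which decreases to ln (2 pi) / 2 = 0.9189... . *)
Definition stirling_log (n : nat) : R :=
  ln n`!%:R - (n%:R + 1 / 2) * ln n%:R + n%:R.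

Lemma stirling_logS n : (0 < n)%N ->
  stirling_log n - stirling_log n.+1 = (n%:R + 1 / 2) * (ln n.+1%:R - ln n%:R) - 1.
Proof.
move=> n0; rewrite /stirling_log factS natrM lnM ?posrE ?ltr0n ?fact_gt0//.
by rewrite -natr1; ring.
Qed.

Lemma lnS_sub_ln n (t := (2 * n%:R + 1)^-1 : R) : (0 < n)%N ->
  ln n.+1%:R - ln n%:R = ln (1 + t) - ln (1 - t).
Proof.
move=> n0; have n0' : 0 < n%:R :> R by rewrite ltr0n.
have m0 : 2 * n%:R + 1 != 0 :> R by apply: lt0r_neq0; lra.
have -> : 1 + t = 2 / (2 * n%:R + 1) * n.+1%:R by rewrite /t -natr1; field.
have -> : 1 - t = 2 / (2 * n%:R + 1) * n%:R by rewrite /t; field.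
have p0 : 0 < 2 / (2 * n%:R + 1) :> R by rewrite divr_gt0//; lra.
by rewrite !lnM ?posrE ?ltr0n//; ring.
Qed.

Lemma stirling_log_S_le n : (0 < n)%N -> stirling_log n.+1 <= stirling_log n.
Proof.
move=> n0; have n0' : 1 <= n%:R :> R by rewrite ler1n.
rewrite -subr_ge0 stirling_logS// lnS_sub_ln// subr_ge0.
set t := (2 * n%:R + 1)^-1.
have t01 : 0 <= t < 1 by rewrite /t invr_ge0 invf_lt1; lra.
rewrite [leLHS](_ : _ = (n%:R + 1 / 2) * (2 * t)); last by rewrite /t; field; apply: lt0r_neq0; lra.
by rewrite ler_wpM2l ?ln_ratio_ge//; lra.
Qed.

(** Subtracting 1 / (12 n) makes the sequence increasing; its value at n = 1 then gives a
lower bound of the limit, 11/12 = 0.9166..., without any knowledge of pi. *)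
Lemma stirling_log_S_ge n : (0 < n)%N ->
  stirling_log n - (12 * n%:R)^-1 <= stirling_log n.+1 - (12 * n.+1%:R)^-1.
Proof.
move=> n0; have n0' : 1 <= n%:R :> R by rewrite ler1n.
suff h : stirling_log n - stirling_log n.+1 <= (12 * n%:R)^-1 - (12 * n.+1%:R)^-1.
  by rewrite lerBlDr -[leRHS]addrA (addrC (- _)) -lerBlDl.
rewrite stirling_logS// lnS_sub_ln//.
set t := (2 * n%:R + 1)^-1.
have t01 : 0 <= t < 1 by rewrite /t invr_ge0 invf_lt1; lra.
have -> : (12 * n%:R)^-1 - (12 * n.+1%:R)^-1 =
  (n%:R + 1 / 2) * (2 * t + 2 / 3 * t ^+ 3 / (1 - t ^+ 2)) - 1.
  rewrite /t -natr1; field.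
  do ?[apply/andP; split]; apply: lt0r_neq0; nra.
by rewrite lerD2r ler_wpM2l ?ln_ratio_le//; lra.
Qed.

Lemma stirling_log_ge n : (0 < n)%N -> 11 / 12 <= stirling_log n.
Proof.
case: n => // n _.
suff : 11 / 12 <= stirling_log n.+1 - (12 * n.+1%:R)^-1.
  by rewrite lerBrDr => /(le_trans _); apply; rewrite lerDl.
elim: n => [|n /le_trans]; last by apply; exact: stirling_log_S_ge.
have -> : stirling_log 1 = 1 by rewrite /stirling_log factS fact0 muln1 ln1 mulr0 sub0r oppr0 add0r.
  lra.
Qed.

Lemma stirling_log_le k n : (0 < k)%N -> (k <= n)%N ->
  stirling_log n <= stirling_log k.
Proof.
move=> k0 /subnK <-; elim: (n - k)%N => // m IH.
by apply: le_trans IH; rewrite addSn stirling_log_S_le// addn_gt0 k0 orbT.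
Qed.

(** The left-hand side is the Stirling term of n minus those of k and n - k, up to the
square roots. The terms of n and n - k cancel favourably, since the sequence decreases, and
only the one of k remains. *)
Lemma ln_bin_le k n : (0 < k < n)%N ->
  ln 'C(n, k)%:R + k%:R * ln (k%:R / n%:R) + (n - k)%:R * ln ((n - k)%:R / n%:R)
    <= - (11 / 12) + (ln n%:R - ln k%:R - ln (n - k)%:R) / 2 :> R.
Proof.
move=> /andP[k0 kn]; have kn' := ltnW kn.
have nk0 : (0 < n - k)%N by rewrite subn_gt0.
have n0 : (0 < n)%N by exact: leq_ltn_trans kn.
have := stirling_log_le nk0 (leq_subr k n).
have := stirling_log_ge k0.
have e : ln n`!%:R = ln 'C(n, k)%:R + ln k`!%:R + ln (n - k)`!%:R :> R.
  by rewrite -(bin_fact kn') !natrM mulrA !lnM// ?posrE ?mulr_gt0 ?ltr0n ?fact_gt0 ?bin_gt0.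
rewrite /stirling_log e !ln_div ?posrE ?ltr0n// natrB//.
by move: (ln _) (ln _) (ln _) (ln _) (ln _) (ln _) => *; lra.
Qed.

(** The difference of the two sides, as a function of x, has a derivative with the sign of
(c - x) * (1 - 2 x) ^ 2. *)
Lemma pinsker_ln (a b x : R) (c := a / (a + b)) : 0 < a -> 0 < b -> 0 < x <= c ->
  a * ln x + b * ln (1 - x) + 2 * (a + b) * (c - x) ^+ 2 <=
  a * ln c + b * ln (1 - c).
Proof.
move=> a0 b0 /andP[x0 xc].
have ab0 : 0 < a + b by lra.
have c1 : c < 1 by rewrite /c ltr_pdivrMr//; lra.
have c0 : 0 < c by rewrite /c divr_gt0.
have aE : a = c * (a + b) by rewrite /c divfK// lt0r_neq0.
have bE : b = (1 - c) * (a + b) by lra.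
pose s := a + b; rewrite -!/s in aE bE ab0 *.
rewrite aE bE; clearbody s c; clear aE bE a0 b0 a b.
pose f y : R := c * s * ln y + (1 - c) * s * ln (1 - y) + 2 * s * (c - y) ^+ 2.
suff : f x <= f c by rewrite /f subrr expr0n/= mulr0 addr0.
pose df y : R := s * (c - y) * (1 - 2 * y) ^+ 2 / (y * (1 - y)).
apply: (@ge0_is_derive_le _ f df x c _ _ xc).
  move=> y; rewrite in_itv/= => /andP[y0 yc].
  have := @is_derive1_ln R y ltac:(lra).
  have := @is_derive_ln1B R y ltac:(lra) => d1 d2.
  apply: is_derive_eq; rewrite /df /GRing.scale/=.
  by field; do ?[apply/andP; split]; apply: lt0r_neq0; lra.
move=> y; rewrite in_itv/= => /andP[y0 yc].
by apply: divr_ge0; [apply: mulr_ge0; [apply: mulr_ge0|exact: sqr_ge0]|apply: mulr_ge0]; lra.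
Qed.

(** A Gaussian bound of the binomial weight to the right of the mean. Squaring keeps the
square root of Stirling's formula out of the later computations. *)
Lemma bernstein_basis_sqr_le n k (x : R) : (0 < k < n)%N -> 0 < x <= k%:R / n%:R ->
  bernstein_basis k n x ^+ 2 <=
  expR (- (11 / 6) - 4 * n%:R * (k%:R / n%:R - x) ^+ 2) *
  (n%:R / (k%:R * (n - k)%:R)).
Proof.
move=> /andP[k0 kn] /andP[x0 xk]; have kn' := ltnW kn.
have n0 : 0 < n%:R :> R by rewrite ltr0n; exact: leq_ltn_trans kn.
have k0' : 0 < k%:R :> R by rewrite ltr0n.
have nk0 : 0 < (n - k)%:R :> R by rewrite ltr0n subn_gt0.
have nE : n%:R = k%:R + (n - k)%:R :> R by rewrite -natrD subnKC.
have c1 : k%:R / n%:R < 1 :> R by rewrite ltr_pdivrMr// mul1r ltr_nat.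
have x1 : 0 < 1 - x by lra.
have C0 : 0 < 'C(n, k)%:R :> R by rewrite ltr0n bin_gt0.
have b0 : 0 < bernstein_basis k n x by rewrite !mulr_gt0// exprn_gt0.
have lnb : ln (bernstein_basis k n x) =
    ln 'C(n, k)%:R + k%:R * ln x + (n - k)%:R * ln (1 - x).
  rewrite /bernstein_basis !lnM ?posrE ?mulr_gt0 ?exprn_gt0//.
  by rewrite !lnXn// ?mulr_natl.
move: (bernstein_basis k n x) b0 lnb => b b0 lnb.
have r0 : 0 < n%:R / (k%:R * (n - k)%:R) :> R by rewrite divr_gt0 ?mulr_gt0.
rewrite -[leRHS]lnK ?posrE ?(mulr_gt0 (expR_gt0 _) r0)//.
rewrite -[leLHS]lnK ?posrE ?exprn_gt0// ler_expR lnXn// lnM ?posrE ?expR_gt0//.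
rewrite expRK ln_div ?posrE ?mulr_gt0// lnM ?posrE// lnb.
have := @ln_bin_le k n; rewrite k0 kn => /(_ isT).
have := @pinsker_ln k%:R (n - k)%:R x k0' nk0.
rewrite -nE x0 xk => /(_ isT).
have -> : (n - k)%:R / n%:R = 1 - k%:R / n%:R :> R.
  by rewrite natrB// mulrBl divff// lt0r_neq0.
move: (ln _) (ln _) (ln _) (ln _) (ln _) (ln _) (ln _) (_ ^+ 2) => *; nra.
Qed.
End Stirling.

(** * Geometric sums and odds ratios *)

Section Geometric.
Context {R : realType}.
Implicit Types (x r d : R) (m n : nat).

Lemma sum_geometric_le r n : 0 <= r < 1 -> \sum_(i < n) r ^+ i <= (1 - r)^-1.
Proof.
move=> /andP[r0 r1].
have := subrX1 r n; rewrite -opprB -(opprB 1) mulNr => /oppr_inj e.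
by rewrite -[leRHS]mul1r ler_pdivlMr ?subr_gt0// mulrC -e lerBlDr lerDl exprn_ge0.
Qed.

(** The sum S of the infinite series satisfies S = 1 / (1 - r) + r ^ m * S, because removing one
from each weight shifts the series by m terms; partial sums obey the same recursion. *)
Lemma sum_staircase_le r m n : (0 < m)%N -> 0 <= r < 1 ->
  \sum_(i < n) (i %/ m).+1%:R * r ^+ i <= (1 - r)^-1 / (1 - r ^+ m).
Proof.
move=> m0 r01; have /andP[r0 r1] := r01.
have rm0 : 0 <= r ^+ m by exact: exprn_ge0.
have rm1 : r ^+ m < 1 by rewrite exprn_ilt1// -lt0n.
have g0 : 0 <= (1 - r)^-1 by rewrite invr_ge0; lra.
set B := _ / _.
have BE : B = (1 - r)^-1 + r ^+ m * B.
  by rewrite /B; field; apply/andP; split; apply: lt0r_neq0; lra.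
have B0 : 0 <= B by rewrite divr_ge0//; lra.
have [l le_nl] := ubnP n; elim: l n le_nl => // l IH n; rewrite ltnS => nl.
have sE : \sum_(i < n) (i %/ m).+1%:R * r ^+ i =
    \sum_(i < n) r ^+ i + \sum_(i < n) (i %/ m)%:R * r ^+ i.
  by rewrite -big_split/=; apply: eq_bigr => i _; rewrite -natr1 mulrDl mul1r addrC.
rewrite sE BE lerD ?sum_geometric_le//.
have [nm|mn] := leqP n m.
  rewrite big1 => [|i _]; first exact: mulr_ge0.
  by rewrite divn_small ?mul0r// (leq_trans (ltn_ord i)).
rewrite -(subnKC (ltnW mn)) big_split_ord/= big1 ?add0r => [|i _]; last first.
  by rewrite divn_small ?mul0r.
rewrite [leLHS](_ : _ = r ^+ m * \sum_(i < n - m) (i %/ m).+1%:R * r ^+ i).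
  by rewrite ler_wpM2l// IH//; lia.
rewrite mulr_sumr; apply: eq_bigr => i _.
by rewrite divnDl ?dvdnn// divnn m0 add1n exprD; ring.
Qed.

Lemma bernoulli_ineq (u : R) m : 0 <= u -> 1 + m%:R * u <= (1 + u) ^+ m.
Proof.
move=> u0; elim: m => [|m IH]; first by rewrite mul0r addr0 expr0.
rewrite exprS -natr1; apply: le_trans (ler_wpM2l _ IH); last by lra.
have : 0 <= m%:R :> R by []. nra.
Qed.

(** The odds ratio of x and x + d is largest when the two points are symmetric about 1/2,
where it equals ((1 - d) / (1 + d)) ^ 2; by Bernoulli's inequality m > 1 / d - 1 factors
(1 + d) / (1 - d) have product at least 3. *)
Lemma odds_ratio_expn_le d x r m : 0 < d < 1 -> 0 <= x -> x + d < 1 ->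
  1 < m.+1%:R * d -> 0 <= r -> r * ((x + d) * (1 - x)) <= (1 - x - d) * x ->
  r ^+ m <= 9^-1.
Proof.
move=> /andP[d0 d1] x0 xd md r0 rle.
pose rho : R := (1 - d) / (1 + d).
have rho0 : 0 < rho by rewrite divr_gt0; lra.
have r_rho : r <= rho ^+ 2.
  have p0 : 0 < (x + d) * (1 - x) by rewrite mulr_gt0; lra.
  rewrite -(ler_pM2r p0); apply: (le_trans rle).
  have -> : rho ^+ 2 * ((x + d) * (1 - x)) =
      (1 - d) ^+ 2 * ((x + d) * (1 - x)) / (1 + d) ^+ 2.
    by rewrite /rho; field; apply: lt0r_neq0; lra.
  rewrite ler_pdivlMr ?exprn_gt0//; last lra.
  by have := mulr_ge0 (ltW d0) (sqr_ge0 (1 - 2 * x - d)); lra.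
have rho3 : rho ^+ m <= 3^-1.
  have rm0 : 0 < rho ^+ m by exact: exprn_gt0.
  rewrite -[leLHS]invrK lef_pV2 ?posrE ?invr_gt0// -exprVn.
  have -> : rho^-1 = 1 + 2 * d / (1 - d).
    by rewrite /rho; field; apply/andP; split; apply: lt0r_neq0; lra.
  apply: le_trans (bernoulli_ineq _ _); last by rewrite divr_ge0; lra.
  rewrite -lerBlDl mulrA ler_pdivlMr; last by lra.
  by move: md; rewrite -natr1; lra.
have -> : 9^-1 = 3^-1 ^+ 2 :> R by field.
apply: (@le_trans _ _ ((rho ^+ 2) ^+ m)).
  by rewrite lerXn2r// ?nnegrE ?sqr_ge0.
by rewrite exprAC lerXn2r// ?nnegrE ?exprn_ge0//; lra.
Qed.
End Geometric.

(** * Polynomial inequalities for the tail bound *)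

Section Numeric.
Context {R : realFieldType}.
Implicit Types (x y d e q s : R).

(** The factor (1 - q + d ^ 2) * (q + d) / (1 + d * (q + d)) of the tail bound increases with
d. So in each region d may be replaced by its largest admissible value, which leaves
inequalities in the single variable q. *)
Lemma tail_factor_mono q d e : 0 <= d <= e -> 0 <= q -> q + e <= 1 ->
  (1 - q + d ^+ 2) * (q + d) * (1 + e * (q + e)) <=
  (1 - q + e ^+ 2) * (q + e) * (1 + d * (q + d)).
Proof.
move=> /andP[d0 de] q0 qe; have e0 : 0 <= e by lra.
have h1 : 0 <= (1 - q) * (1 - q ^+ 2 - q * (d + e) - d * e).
  by apply: mulr_ge0; nra.
rewrite -subr_ge0 [leRHS](_ : _ = (e - d) *
   ((1 - q) * (1 - q ^+ 2 - q * (d + e) - d * e) + q * (d + e) + d ^+ 2 + d * e +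
    e ^+ 2 + q ^+ 2 * (d * e) + q * (d * e) * (d + e) + (d * e) ^+ 2)); last by ring.
have de0 : 0 <= d * e by exact: mulr_ge0.
apply: mulr_ge0; first lra.
by do ?[exact: h1 | exact: sqr_ge0 | apply: addr_ge0 | apply: mulr_ge0]; lra.
Qed.

(** With q = 1 - x - d, the fraction tail_num / tail_den is the square of the factor that
remains of the tail bound beyond x + d besides its exponential. *)
Definition tail_num q d : R := ((1 - q + d ^+ 2) * (q + d)) ^+ 2.
Definition tail_den q d : R := (1 + d * (q + d)) ^+ 2 * ((1 - q) * q).

Lemma tail_le_mono c q d e : 0 <= d <= e -> 0 <= q -> q + e <= 1 ->
  tail_num q e <= c * tail_den q e -> tail_num q d <= c * tail_den q d.
Proof.
move=> /andP[d0 de] q0 qe; have e0 : 0 <= e by lra.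
have e1 : 0 < 1 + e * (q + e) by nra.
have d1 : 0 < 1 + d * (q + d) by nra.
have N0 : 0 <= (1 - q + d ^+ 2) * (q + d) by apply: mulr_ge0; nra.
have sq0 (t : R) : 0 < t -> 0 < t ^+ 2 by move=> ?; exact: exprn_gt0.
rewrite /tail_num /tail_den !(mulrCA c (_ ^+ 2)) ![_ ^+ 2 * (c * _)]mulrC.
rewrite -(ler_pdivrMr _ _ (sq0 _ e1)) -(ler_pdivrMr _ _ (sq0 _ d1)) => h; apply: le_trans h.
rewrite -!expr_div_n lerXn2r// ?nnegrE ?divr_ge0 ?(ltW e1) ?(ltW d1)//.
  by apply: mulr_ge0; nra.
rewrite ler_pdivrMr// mulrAC ler_pdivlMr//.
by apply: tail_factor_mono; rewrite // d0 de.
Qed.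

Lemma tail_le_right q d : 1 / 2 <= q -> 0 <= d -> 3 * d <= 1 - q ->
  tail_num q d <= 27 / 50 * tail_den q d.
Proof.
move=> q2 d0 dq.
have k1 : 1 - q + d ^+ 2 <= (1 - q) * (19 / 18) by nra.
have q1 : q + d <= 4 / 3 * q by nra.
have h : (1 - q + d ^+ 2) * (q + d) <= (1 - q) * (19 / 18) * (4 / 3 * q).
  by apply: ler_pM => //; nra.
apply: (@le_trans _ _ (((1 - q) * (19 / 18) * (4 / 3 * q)) ^+ 2)).
  rewrite lerXn2r// nnegrE; first by apply: mulr_ge0; nra.
  by do ?apply: mulr_ge0; lra.
have k0 : 0 <= (1 - q) * q <= 1 / 4 by apply/andP; split; nra.
have v1 : 1 <= (1 + d * (q + d)) ^+ 2 by rewrite exprn_ege1//; nra.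
rewrite /tail_den [leLHS](_ : _ = 361 / 324 * (16 / 9) * ((1 - q) * q) ^+ 2); last by field.
move: k0 v1; move: ((1 - q) * q) (_ ^+ 2) => u v /andP[u0 u4] v1; nra.
Qed.

(** The case in which a second extra step can occur: then q >= 2 * d, and the bound has to leave
room for the factor 9/8. *)
Lemma tail_le_second_step q d : 0 < d -> 2 * d <= q -> d <= 1 / 5 -> 3 * d <= 1 - q ->
  tail_num q d <= 27 / 50 * tail_den q d.
Proof.
move=> d0 dq d1 dq3.
have [q2|q2] := ltP q (1 / 2); last by apply: tail_le_right; lra.
(* Here d is at most min (q/2) (1/5). *)
have [qd|/ltW qd] := leP q (4 / 10).
  apply: (@tail_le_mono _ _ _ (q / 2)); [lra|lra|lra|].
  have q0 : 0 <= q by lra.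
  rewrite /tail_num /tail_den.
  have -> : ((1 - q + (q / 2) ^+ 2) * (q + q / 2)) ^+ 2 = q * (9 / 4 * q * (1 - q + (q / 2) ^+ 2) ^+ 2) by field.
  have -> : 27 / 50 * ((1 + q / 2 * (q + q / 2)) ^+ 2 * ((1 - q) * q)) = q * (27 / 50 * (1 + 3 / 4 * q ^+ 2) ^+ 2 * (1 - q)) by field.
  rewrite ler_wpM2l//; clear - q0 qd.
  have /andP[v0 v1] : 0 <= 1 - q + (q / 2) ^+ 2 <= 1 - 9 / 10 * q by apply/andP; split; nra.
  apply: (@le_trans _ _ (9 / 4 * q * (1 - 9 / 10 * q) ^+ 2)).
    rewrite ler_wpM2l//; first by rewrite mulr_ge0//; lra.
    by rewrite lerXn2r// ?nnegrE; lra.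
  apply: (@le_trans _ _ (27 / 50 * (1 + 3 / 2 * q ^+ 2) * (1 - q))).
    nra.
  apply: ler_wpM2r; first lra.
  apply: ler_wpM2l; first lra.
  by have := sqr_ge0 (q ^+ 2); lra.
apply: (@tail_le_mono _ _ _ (1 / 5)); [lra|lra|lra|].
rewrite /tail_num /tail_den; clear - qd q2.
nra.
Qed.

(** The tightest case. The fraction is about 0.683 at q = d = 1 / sqrt 17, that is for n = 17 with
x close to 1/2, and at most 11/16 is required. *)
Lemma tail_le_two_sided q d : 0 < d -> d <= q -> d <= 17 / 70 -> 3 * d <= 1 - q ->
  tail_num q d <= 11 / 16 * tail_den q d.
Proof.
move=> d0 dq d1 dq3.
have [q2|q2] := ltP q (1 / 2); last first.
  apply: le_trans (tail_le_right q2 (ltW d0) dq3) _.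
  apply: ler_wpM2r; last lra.
  by apply: mulr_ge0; [exact: sqr_ge0|apply: mulr_ge0; lra].
(* 17/70 is slightly more than 1 / sqrt 17; d is at most min q (17/70). *)
have [qd|/ltW qd] := leP q (17 / 70).
  apply: (@tail_le_mono _ _ _ q); [lra|lra|lra|].
  rewrite /tail_num /tail_den.
  have -> : ((1 - q + q ^+ 2) * (q + q)) ^+ 2 = q * (4 * q * (1 - q + q ^+ 2) ^+ 2) by ring.
  have -> : 11 / 16 * ((1 + q * (q + q)) ^+ 2 * ((1 - q) * q)) = q * (11 / 16 * (1 + 2 * q ^+ 2) ^+ 2 * (1 - q)) by ring.
  rewrite ler_wpM2l//; first lra.
  have q0 : 0 <= q by lra.
  clear - q0 qd.
  pose u := 17 / 70 - q.
  have u0 : 0 <= u by rewrite /u; lra.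
  have -> : q = 17 / 70 - u by rewrite /u; ring.
  have := exprn_ge0 2 u0; have := exprn_ge0 3 u0.
  have := exprn_ge0 4 u0; have := exprn_ge0 5 u0.
  by clear - u0; lra.
have de : 0 <= d <= 17 / 70 by lra.
apply: (tail_le_mono de); [lra|lra|].
rewrite /tail_num /tail_den; clear - qd q2.
pose u := q - 17 / 70.
have u0 : 0 <= u by rewrite /u; lra.
have u1 : u <= 9 / 35 by rewrite /u; lra.
have -> : q = 17 / 70 + u by rewrite /u; ring.
have := exprn_ge0 2 u0; have u3 := exprn_ge0 3 u0.
have := ler_wpM2r u3 u1.
by clear - u0 u3; lra.
Qed.

(** Only a crude bound is needed when extra steps occur on one side, since the
whole of c - 1 is then available. *)
Lemma tail_le_one_sided q d : 0 < d -> d <= q -> d <= 1 - q ->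
  tail_num q d <= (1 + d) ^+ 2 * tail_den q d.
Proof.
move=> d0 dq dk.
have k1 : 1 - q + d ^+ 2 <= (1 - q) * (1 + d) by nra.
have k0 : 0 <= (1 - q) * q <= 1 / 4.
  by have := sqr_ge0 (q - 1 / 2) => ?; apply/andP; split; [apply: mulr_ge0|]; lra.
have kd0 : 0 <= 1 - q + d ^+ 2 by have := sqr_ge0 d; lra.
apply: (@le_trans _ _ (((1 - q) * (1 + d) * (2 * q)) ^+ 2)).
  rewrite /tail_num lerXn2r ?nnegrE//; last by apply: ler_pM => //; lra.
    by apply: mulr_ge0 => //; lra.
  by do ?apply: mulr_ge0; lra.
have v1 : 1 <= (1 + d * (q + d)) ^+ 2 by rewrite exprn_ege1//; nra.
have -> : ((1 - q) * (1 + d) * (2 * q)) ^+ 2 =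
  (1 + d) ^+ 2 * (4 * ((1 - q) * q) ^+ 2) by ring.
rewrite /tail_den ler_wpM2l ?sqr_ge0//.
move: k0 v1; move: ((1 - q) * q) (_ ^+ 2) => u v /andP[u0 u4] v1; nra.
Qed.

(** The first index beyond x + d gives a point x + d * (1 + s) of the grid with 0 <= s <= d.
This shows that s = 0 is the worst case: the exponential factor, bounded by
1 / (1 + 4 s) ^ 2 in the square, decreases fast enough to absorb the growth of the other factors. *)
Lemma tail_le_shift q d s : 0 < d -> d <= q -> d <= 1 - q -> 0 <= s -> s <= d -> d <= 1 / 2 ->
  ((1 - q + d * s + d ^+ 2) * (q + d)) ^+ 2 * tail_den q d <=
  tail_num q d * ((1 - q + d * s) * (q - d * s) *
                  ((1 + s + d * (q + d)) * (1 + 4 * s)) ^+ 2).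
Proof.
move=> d0 dq dk s0 sd d2.
set k := 1 - q in dk *; set v := 1 + d * (q + d).
have kp : 0 < k by lra. have qp : 0 < q by lra.
have ds0 : 0 <= d * s by rewrite mulr_ge0// ltW.
have hA : (k + d * s + d ^+ 2) ^+ 2 * k <= (k + d ^+ 2) ^+ 2 * (k + d * s) * (1 + s).
  have kk : k + d * s <= k * (1 + s) by nra.
  rewrite -subr_ge0 [leRHS](_ : _ = (k * (1 + s) - (k + d * s)) * k * (k + d * s)
     + 2 * d ^+ 2 * s * (k * (k + d * s)) + d ^+ 4 * (d * s + (k + d * s) * s)); last by ring.
  have ks0 : 0 <= (k + d * s) * s by apply: mulr_ge0; lra.
  apply: addr_ge0; [apply: addr_ge0|].
  - by apply: mulr_ge0; [apply: mulr_ge0|]; lra.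
  - by apply: mulr_ge0; [do ?apply: mulr_ge0; rewrite ?sqr_ge0//; lra|apply: mulr_ge0; lra].
  - by apply: mulr_ge0; [apply: exprn_ge0; lra|lra].
have hB : q * (1 - s) <= q - d * s by nra.
have hC : v ^+ 2 <= (1 + s + d * (q + d)) ^+ 2.
  by rewrite lerXn2r ?nnegrE /v; nra.
(* The exponential factor absorbs the losses 1 + s of hA and 1 - s of hB. *)
have hE : 1 + s <= (1 - s) * (1 + 4 * s) ^+ 2 by nra.
rewrite /tail_num /tail_den -/k -/v.
have y0 : 0 <= (q + d) ^+ 2 by exact: sqr_ge0.
have v0 : 0 <= v ^+ 2 by exact: sqr_ge0.
apply: (@le_trans _ _ ((k + d ^+ 2) ^+ 2 * (k + d * s) * (1 + s) * (q * (q + d) ^+ 2 * v ^+ 2))).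
  rewrite [leLHS](_ : _ = (k + d * s + d ^+ 2) ^+ 2 * k * (q * (q + d) ^+ 2 * v ^+ 2)); last by ring.
  by apply: ler_wpM2r => //; rewrite mulr_ge0// mulr_ge0// ltW.
have K0 : 0 <= (k + d ^+ 2) ^+ 2 * (k + d * s) by rewrite mulr_ge0 ?sqr_ge0//; lra.
rewrite [leRHS](_ : _ = (k + d ^+ 2) ^+ 2 * (k + d * s) * 
   ((1 + 4 * s) ^+ 2 * (q - d * s) * ((q + d) ^+ 2) * (1 + s + d * (q + d)) ^+ 2)); last by ring.
rewrite -mulrA; apply: ler_wpM2l => //.
move: ((q + d) ^+ 2) (v ^+ 2) ((1 + s + d * (q + d)) ^+ 2) y0 v0 hC => Y V W Y0 V0 VW.
rewrite mulrA; apply: ler_pM => //.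
  by apply: mulr_ge0; [lra|apply: mulr_ge0 => //; exact: ltW].
rewrite mulrA; apply: ler_wpM2r => //.
apply: (@le_trans _ _ ((1 - s) * (1 + 4 * s) ^+ 2 * q)).
  by apply: ler_wpM2r => //; exact: ltW.
rewrite [leLHS](_ : _ = (1 + 4 * s) ^+ 2 * (q * (1 - s))); last by ring.
by apply: ler_wpM2l => //; exact: sqr_ge0.
Qed.
End Numeric.

(** * The binomial tail beyond one standard step *)

Section Tail.
Context {R : realType}.
Implicit Types (x d : R) (n k : nat).

(** The exponent 35/6 = 11/6 + 4 collects twice the Stirling constant 11/12 and the Gaussian
exponent 4 at distance d. The rational number 50/923 = 1/18.46 is close to e ^ (- 35/12) = 1/18.479... . *)
Lemma expR_35_6_le : expR (- (35 / 6)) <= (50 / 923) ^+ 2 :> R.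
Proof.
(* 347/241 is just below e ^ (35/96), and its 16th power exceeds 18.46 ^ 2. *)
have lnq : ln (347 / 241) <= 35 / 96 :> R.
  have t01 : 0 <= (53 / 294 : R) < 1 by apply/andP; split; lra.
  have := ln_ratio_le t01.
  rewrite -ln_div ?posrE; [|lra|lra].
  have -> : (1 + 53 / 294) / (1 - 53 / 294) = 347 / 241 :> R by field.
  move=> h; apply: (le_trans h).
  rewrite -lerBrDl ler_pdivrMr; lra.
have qe : (347 / 241) ^+ 16 <= expR (35 / 6) :> R.
  have -> : 35 / 6 = 16%:R * (35 / 96) :> R by field.
  rewrite expRM_natl; apply: lerXn2r; rewrite ?nnegrE; [lra|exact: expR_ge0|].
  have q0 : 0 < 347 / 241 :> R by lra.
  by rewrite -[leLHS](lnK q0) ler_expR.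
rewrite expRN -[leRHS]invrK lef_pV2 ?posrE ?invr_gt0; [|exact: expR_gt0|by apply: exprn_gt0; lra].
apply: le_trans qe.
have q2 : 284 / 137 <= (347 / 241) ^+ 2 :> R by lra.
have q4 : 159 / 37 <= ((347 / 241) ^+ 2) ^+ 2 :> R.
  apply: (@le_trans _ _ ((284 / 137) ^+ 2)); first lra.
  by apply: lerXn2r; rewrite ?nnegrE; [lra|exact: sqr_ge0|exact: q2].
have q8 : 923 / 50 <= (((347 / 241) ^+ 2) ^+ 2) ^+ 2 :> R.
  apply: (@le_trans _ _ ((159 / 37) ^+ 2)); first lra.
  by apply: lerXn2r; rewrite ?nnegrE; [lra|exact: sqr_ge0|exact: q4].
rewrite -exprVn invf_div (exprM _ 8 2) (exprM _ 4 2) (exprM _ 2 2).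
by apply: lerXn2r; rewrite ?nnegrE; [lra|exact: sqr_ge0|exact: q8].
Qed.


(** The quotient of the consecutive weights p_{k+1,n}(x) and p_{k,n}(x). *)
Definition basis_ratio n k x : R :=
  (n - k)%:R * x / (k.+1%:R * (1 - x)).

Lemma basis_ratio_ge0 n k x : 0 <= x < 1 -> 0 <= basis_ratio n k x.
Proof.
by move=> /andP[x0 x1]; rewrite divr_ge0 ?mulr_ge0//; lra.
Qed.

Lemma bernstein_basis_ge0 n k x : 0 <= x <= 1 -> 0 <= bernstein_basis k n x.
Proof.
by move=> /andP[x0 x1]; rewrite !mulr_ge0 ?exprn_ge0//; lra.
Qed.

Lemma bernstein_basisS n k x : 0 <= x < 1 ->
  bernstein_basis k.+1 n x = basis_ratio n k x * bernstein_basis k n x.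
Proof.
move=> /andP[x0 x1]; have x1' : 1 - x != 0 by apply: lt0r_neq0; lra.
rewrite /bernstein_basis /basis_ratio.
have [nk|kn] := leqP n k.
  by rewrite bin_small ?ltnS// (eqP nk) !mul0r.
have e : k.+1%:R * 'C(n, k.+1)%:R = (n - k)%:R * 'C(n, k)%:R :> R.
  by rewrite -!natrM mul_bin_left.
have k0 : k.+1%:R != 0 :> R by rewrite pnatr_eq0.
have nk : (n - k = (n - k.+1).+1)%N by lia.
rewrite nk in e *; move: e; set N := ((n - k.+1).+1)%:R; rewrite !exprS => e.
have -> : 'C(n, k.+1)%:R = N * 'C(n, k)%:R / k.+1%:R :> R by rewrite -e mulrC mulKf.
clear e.
by move: (k.+1%:R : R) k0 => c k0; field; rewrite x1' k0.
Qed.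

Lemma basis_ratio_le n k j x : 0 <= x < 1 -> (k <= j)%N ->
  basis_ratio n j x <= basis_ratio n k x.
Proof.
move=> /andP[x0 x1] kj.
have x1' : 0 < 1 - x by lra.
rewrite /basis_ratio ler_pM ?invr_ge0 ?mulr_ge0 ?(ltW x1')//.
  by rewrite ler_wpM2r// ler_nat leq_sub2l.
by rewrite lef_pV2 ?posrE ?mulr_gt0 ?ltr0n// ler_wpM2r ?(ltW x1')// ler_nat ltnS.
Qed.

Lemma bernstein_basis_geometric n k i x : 0 <= x < 1 ->
  bernstein_basis (k + i) n x <= basis_ratio n k x ^+ i * bernstein_basis k n x.
Proof.
move=> x01; have x01' : 0 <= x <= 1 by case/andP: x01 => -> /ltW.
elim: i => [|i IH]; first by rewrite addn0 mul1r.
rewrite addnS bernstein_basisS// exprS -mulrA.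
apply: ler_pM => //; rewrite ?basis_ratio_ge0 ?bernstein_basis_ge0//.
by rewrite basis_ratio_le// leq_addr.
Qed.

(** The geometric bound of the tail that starts at k, for a grid point k / n that lies
beyond x + d by at most the mesh 1 / n = d ^ 2. *)
Lemma bernstein_tail_sqr_le n k x d (q := 1 - x - d) :
  0 < d <= 1 / 2 -> d ^+ 2 * n%:R = 1 -> 0 < x -> d <= q -> (k < n)%N ->
  x + d <= k%:R / n%:R <= x + d + d ^+ 2 ->
  (bernstein_basis k n x / (1 - basis_ratio n k x)) ^+ 2 * tail_den q d <=
  (50 / 923) ^+ 2 * tail_num q d.
Proof.
move=> /andP[d0 d2] dn x0 dq kn /andP[k1 k2].
have n0 : 0 < n%:R :> R by rewrite ltr0n (leq_ltn_trans _ kn).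
have nE : n%:R = d ^- 2 :> R.
  by rewrite -[RHS]mulr1 -[X in _ = _ * X]dn mulKf// lt0r_neq0// exprn_gt0.
have k0 : 0 < k%:R :> R.
  by have : 0 < k%:R / n%:R :> R by [lra]; rewrite pmulr_lgt0// invr_gt0.
pose s := (k%:R / n%:R - x) / d - 1.
have sE : k%:R / n%:R = x + d * (1 + s).
  by rewrite /s; field; rewrite !lt0r_neq0.
have s0 : 0 <= s by rewrite -(pmulr_rge0 _ d0); rewrite sE in k1; lra.
have sd : s <= d by rewrite -(ler_pM2l d0); rewrite sE in k2; lra.
have kE : k%:R = d ^- 2 * (1 - q + d * s).
  by rewrite -nE -[LHS](divfK (lt0r_neq0 n0)) sE /q; ring.
have nkE : (n - k)%:R = d ^- 2 * (q - d * s).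
  by rewrite natrB ?(ltnW kn)// kE nE; ring.
have xE : x = 1 - q - d by rewrite /q; ring.
pose w := 1 + s + d * (q + d).
have w0 : 0 < w by rewrite /w; nra.
have kq0 : 0 < 1 - q + d * s by rewrite /q; nra.
have qs0 : 0 < q - d * s by nra.
have y0 : 0 < 1 - x by rewrite /q in dq; lra.
have K0 : 0 < 1 - q + d * s + d ^+ 2 by rewrite addr_gt0// exprn_gt0.
have FE : (1 - basis_ratio n k x)^-1 =
    (1 - q + d * s + d ^+ 2) * (q + d) / (d * w).
  rewrite -invf_div; congr (_^-1).
  rewrite /basis_ratio -natr1 nkE kE xE /w.
  by field; do ?[apply/andP; split]; apply: lt0r_neq0; lra.
have b2 : bernstein_basis k n x ^+ 2 <= (50 / 923) ^+ 2 / (1 + 4 * s) ^+ 2 *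
    (d ^+ 2 / ((1 - q + d * s) * (q - d * s))).
  have k0n : (0 < k < n)%N by rewrite kn andbT -(ltr_nat R).
  apply: le_trans (bernstein_basis_sqr_le k0n _) _.
    by rewrite x0 sE lerDl mulr_ge0 ?ltW//; lra.
  have -> : n%:R / (k%:R * (n - k)%:R) =
      d ^+ 2 / ((1 - q + d * s) * (q - d * s)).
    by rewrite nkE kE nE; field; do ?[apply/andP; split]; apply: lt0r_neq0.
  apply: ler_wpM2r.
    by rewrite divr_ge0 ?sqr_ge0// mulr_ge0// ltW.
  have -> : - (11 / 6) - 4 * n%:R * (k%:R / n%:R - x) ^+ 2 =
      - (35 / 6) + - (2%:R * (4 * s)) - 4 * s ^+ 2.
    by rewrite sE nE; field; apply: lt0r_neq0.
  apply: (@le_trans _ _ (expR (- (35 / 6) + - (2%:R * (4 * s))))).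
    by rewrite ler_expR lerBlDr lerDl mulr_ge0// sqr_ge0.
  rewrite expRD; apply: ler_pM; rewrite ?expR_ge0 ?expR_35_6_le//.
  rewrite expRN expRM_natl lef_pV2 ?posrE ?exprn_gt0 ?expR_gt0//; last by lra.
  by rewrite lerXn2r ?nnegrE ?expR_ge0 ?expR_ge1Dx//; lra.
have k_d : d <= 1 - q by rewrite /q; lra.
have sh := tail_le_shift d0 dq k_d s0 sd d2.
have den0 : 0 <= tail_den q d.
  by apply: mulr_ge0; [exact: sqr_ge0|apply: mulr_ge0; lra].
rewrite FE [leLHS](_ : _ = bernstein_basis k n x ^+ 2 *
    (((1 - q + d * s + d ^+ 2) * (q + d) / (d * w)) ^+ 2 * tail_den q d)); last first.
  by move: (bernstein_basis k n x) (_ / (d * w)) (tail_den q d) => b F D; ring.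
apply: (@le_trans _ _ ((50 / 923) ^+ 2 / (1 + 4 * s) ^+ 2 *
    (d ^+ 2 / ((1 - q + d * s) * (q - d * s))) *
    (((1 - q + d * s + d ^+ 2) * (q + d) / (d * w)) ^+ 2 * tail_den q d))).
  by apply: ler_wpM2r => //; rewrite mulr_ge0 ?sqr_ge0.
rewrite [leLHS](_ : _ = (50 / 923) ^+ 2 *
  (((1 - q + d * s + d ^+ 2) * (q + d)) ^+ 2 * tail_den q d /
   ((1 - q + d * s) * (q - d * s) * (w * (1 + 4 * s)) ^+ 2))); last first.
  by field; do ?[apply/andP; split]; apply: lt0r_neq0; lra.
apply: ler_wpM2l; first exact: sqr_ge0.
rewrite ler_pdivrMr// mulr_gt0 ?exprn_gt0 ?mulr_gt0//.
lra.
Qed.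

End Tail.

(** * The mean number of extra steps *)

Section Overshoot.
Context {R : realType}.
Implicit Types (x d : R) (n k : nat).

Definition first_far n d x : nat := (Num.trunc (n%:R * x + d^-1)).+1.

(** The number of extra steps, besides the two unavoidable ones, that may be needed to
reach from x a point to its right which is close to k / n. The tests on 1 - x express
that no point of [0, 1] to the right of x is further away than that. The index first_far
is the first one with k / n > x + d, and floor (1 / d) = floor (sqrt n) further indices
cost at most one more step. *)
Definition overshoot n d x k : nat :=
  if (1 - x <= 2 * d) || (k < first_far n d x)%N then 0
  else if 1 - x <= 3 * d then 1
  else ((k - first_far n d x) %/ Num.trunc d^-1).+1.

Lemma first_far_itv n d x : 0 < d -> d ^+ 2 * n%:R = 1 -> 0 <= x ->
  x + d < (first_far n d x)%:R / n%:R <= x + d + d ^+ 2.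
Proof.
move=> d0 dn x0.
have n0 : 0 < n%:R :> R.
  by rewrite -(pmulr_rgt0 _ (exprn_gt0 2 d0)) dn.
have dE : d * n%:R = d^-1.
  by apply: (mulfI (lt0r_neq0 d0)); rewrite mulrA -expr2 dn mulfV// lt0r_neq0.
have p0 : 0 <= n%:R * x + d^-1 by rewrite addr_ge0 ?mulr_ge0 ?invr_ge0 ?(ltW d0).
have := truncn_itv p0.
rewrite -/(first_far n d x); have -> : (first_far n d x)%:R = (Num.trunc (n%:R * x + d^-1))%:R + 1 :> R.
  by rewrite natr1.
move: (Num.trunc _)%:R => t /andP[t1 t2].
by rewrite ltr_pdivlMr// ler_pdivrMr// !mulrDl dE dn; apply/andP; split; lra.
Qed.

Lemma first_far_lt n d x : 0 < d -> d ^+ 2 * n%:R = 1 -> 0 <= x -> 2 * d < 1 - x ->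
  (first_far n d x < n)%N.
Proof.
move=> d0 dn x0 xd.
have n0 : 0 < n%:R :> R.
  by rewrite -(pmulr_rgt0 _ (exprn_gt0 2 d0)) dn.
have /andP[_] := first_far_itv d0 dn x0.
rewrite ler_pdivrMr// => h; rewrite -(ltr_nat R); apply: (le_lt_trans h).
rewrite -{2}(mul1r n%:R) ltr_pM2r//; nra.
Qed.

(** The sum starts at the first far index k, where the weights are dominated by a geometric
progression of ratio r; the number of steps is a staircase of width floor (1 / d). *)
Lemma overshoot_sum_le n d x (k := first_far n d x)
    (U := bernstein_basis k n x / (1 - basis_ratio n k x)) :
  0 < d -> d ^+ 2 * n%:R = 1 -> 0 <= x -> 2 * d < 1 - x ->
  0 <= U /\
  \sum_(j < n.+1) (overshoot n d x j)%:R * bernstein_basis j n x <=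
    U * (if 1 - x <= 3 * d then 1 else 9 / 8).
Proof.
move=> d0 dn x0 xd.
have kn : (k < n)%N by exact: first_far_lt.
have x01 : 0 <= x < 1 by lra.
have x01' : 0 <= x <= 1 by lra.
have b0 : 0 <= bernstein_basis k n x by exact: bernstein_basis_ge0.
set r := basis_ratio n k x in U *.
have r0 : 0 <= r by exact: basis_ratio_ge0.
have n0 : 0 < n%:R :> R.
  by rewrite -(pmulr_rgt0 _ (exprn_gt0 2 d0)) dn.
have rle : r * ((x + d) * (1 - x)) <= (1 - x - d) * x.
  have /andP[k1 _] := first_far_itv d0 dn x0; rewrite -/k in k1.
  move: k1; rewrite ltr_pdivlMr// => k1.
  rewrite /r /basis_ratio natrB ?(ltnW kn)// -natr1.
  have K0 : 0 <= k%:R :> R by [].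
  rewrite mulrAC ler_pdivrMr; last by apply: mulr_gt0; lra.
  have h : (n%:R - k%:R) * (x + d) <= (k%:R + 1) * (1 - x - d) by lra.
  have p : 0 <= x * (1 - x) by apply: mulr_ge0; lra.
  by have := ler_wpM2r p h; lra.
have r1 : r < 1.
  have p0 : 0 < (x + d) * (1 - x) by apply: mulr_gt0; lra.
  by rewrite -(ltr_pM2r p0); apply: le_lt_trans rle _; lra.
have U0 : 0 <= U by rewrite divr_ge0//; lra.
split=> //.
rewrite -(subnKC (leqW (ltnW kn))).
rewrite big_split_ord/= big1 ?add0r => [|i _]; last first.
  by rewrite /overshoot ltn_ord orbT mul0r.
have geo i : bernstein_basis (k + i) n x <= r ^+ i * bernstein_basis k n x.
  exact: bernstein_basis_geometric.
have x2F := lt_geF xd.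
have lk i : (k + i < k)%N = false by rewrite ltnNge leq_addr.
have [x3|x3] := leP (1 - x) (3 * d).
  rewrite mulr1; apply: (@le_trans _ _ (\sum_(i < n.+1 - k) r ^+ i * bernstein_basis k n x)).
    by apply: ler_sum => i _; rewrite /overshoot lk orbF x2F/= x3 mul1r.
  rewrite -mulr_suml mulrC; apply: ler_wpM2l => //.
  by apply: sum_geometric_le; rewrite r0.
apply: (@le_trans _ _ (\sum_(i < n.+1 - k) (i %/ Num.trunc d^-1).+1%:R * r ^+ i * bernstein_basis k n x)).
  apply: ler_sum => i _; rewrite /overshoot lk orbF x2F (lt_geF x3)/= addKn -mulrA.
  by apply: ler_wpM2l.
have d1 : d < 1 by lra.
have m0 : (0 < Num.trunc d^-1)%N by rewrite truncn_gt0 invr_ge1 ?unitfE ?lt0r_neq0// ltW.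
have rm : r ^+ Num.trunc d^-1 <= 9^-1.
  apply: (@odds_ratio_expn_le _ d x) => //; first by rewrite d0; lra.
    by lra.
  have h := truncnS_gt d^-1.
  by rewrite -(ltr_pM2r d0) mulVf ?lt0r_neq0 in h.
rewrite -mulr_suml mulrC /U -mulrA; apply: ler_wpM2l => //.
apply: le_trans (sum_staircase_le _ m0 _) _; first by rewrite r0.
apply: ler_wpM2l; first by rewrite invr_ge0; lra.
rewrite -[leRHS]invrK lef_pV2 ?posrE ?invr_gt0; lra.
Qed.

Lemma le_of_sqr_le (a b c u num den : R) : 0 <= b -> 0 < den ->
  u ^+ 2 * den <= a ^+ 2 * num -> num <= c * den -> a ^+ 2 * c <= b ^+ 2 -> u <= b.
Proof.
move=> b0 den0 h1 h2 h3.
have [u0|/ltW u0] := leP u 0; first exact: le_trans u0 b0.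
rewrite -(@ler_pXn2r _ 2) ?nnegrE//; apply: le_trans h3.
rewrite -(ler_pM2r den0); apply: (le_trans h1).
by rewrite -[leRHS]mulrA; apply: ler_wpM2l => //; exact: sqr_ge0.
Qed.

Lemma first_far_tail_le n d x c b (k := first_far n d x) (q := 1 - x - d) :
  0 < d -> d ^+ 2 * n%:R = 1 -> 0 <= x -> 2 * d < 1 - x -> 0 <= b ->
  tail_num q d <= c * tail_den q d -> (50 / 923) ^+ 2 * c <= b ^+ 2 ->
  bernstein_basis k n x / (1 - basis_ratio n k x) <= b.
Proof.
move=> d0 dn; rewrite le_eqVlt => /predU1P[<-|x0] xd b0 hc hb.
  by rewrite /bernstein_basis /k /first_far expr0n/= mulr0 !mul0r.
apply: (le_of_sqr_le b0 _ _ hc hb).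
  by apply: mulr_gt0; rewrite ?exprn_gt0 ?mulr_gt0//; rewrite /q; nra.
apply: bernstein_tail_sqr_le => //; rewrite /q; try lra.
- by apply: first_far_lt => //; exact: ltW.
- by have /andP[/ltW-> ->] := first_far_itv d0 dn (ltW x0).
Qed.

Definition overshoot_mean n d x : R :=
  \sum_(j < n.+1) (overshoot n d x j)%:R * bernstein_basis j n x.

Lemma overshoot_mean_eq0 n d x : 1 - x <= 2 * d -> overshoot_mean n d x = 0.
Proof.
move=> xd; rewrite /overshoot_mean big1// => j _.
by rewrite /overshoot xd mul0r.
Qed.

(** The bound 31/690 is slightly less than (c - 1) / 2. The hypotheses force n >= 17, and
5 * d < 1 if there can be a second extra step. *)
Lemma overshoot_mean_le_half n d x : 0 < d -> d ^+ 2 * n%:R = 1 -> 2 * d < x ->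
  2 * d < 1 - x -> overshoot_mean n d x <= 31 / 690.
Proof.
move=> d0 dn dx xd; have x0 : 0 <= x by lra.
have [U0] := overshoot_sum_le d0 dn x0 xd.
move/le_trans; apply.
have [x3|x3] := leP (1 - x) (3 * d).
  rewrite mulr1; apply: (first_far_tail_le d0 dn x0 xd (c := 11 / 16)); [lra| |lra].
  have n16 : (16 < n)%N by rewrite -(ltr_nat R); nra.
  have n17 : 17 <= n%:R :> R by rewrite (ler_nat R 17).
  apply: tail_le_two_sided; try lra.
  nra.
have : 8 / 9 * (31 / 690) * (9 / 8) <= 31 / 690 :> R by lra.
apply: le_trans; apply: ler_wpM2r; first by lra.
apply: (first_far_tail_le d0 dn x0 xd (c := 27 / 50)); [lra| |lra].
by apply: tail_le_second_step; lra.
Qed.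

(** The bound 31/345 is slightly less than c - 1. *)
Lemma overshoot_mean_le n d x : 0 < d -> d ^+ 2 * n%:R = 1 -> 0 <= x ->
  overshoot_mean n d x <= 31 / 345.
Proof.
move=> d0 dn x0.
have [xd|xd] := leP (1 - x) (2 * d); first by rewrite (overshoot_mean_eq0 _ xd); lra.
have [U0] := overshoot_sum_le d0 dn x0 xd.
move/le_trans; apply.
have : 8 / 9 * (31 / 345) * (9 / 8) <= 31 / 345 :> R by lra.
apply: le_trans; apply: ler_pM; [exact: U0|by case: ifP; lra| |by case: ifP; lra].
have n4 : (4 < n)%N by rewrite -(ltr_nat R); nra.
have n5 : 5 <= n%:R :> R by rewrite (ler_nat R 5).
have d1 : d ^+ 2 <= 1 / 5 by nra.
have d2 : (1 + d) ^+ 2 <= 21 / 10 by nra.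
apply: (first_far_tail_le d0 dn x0 xd (c := (1 + d) ^+ 2)); [lra| |lra].
by apply: tail_le_one_sided; lra.
Qed.

(** Extra steps to the left of x are extra steps to the right of 1 - x after the reflection of [0, 1]. *)
Lemma overshoot_mean_pair_le n d x : 0 < d -> d ^+ 2 * n%:R = 1 -> 0 <= x <= 1 ->
  overshoot_mean n d x + overshoot_mean n d (1 - x) <= 31 / 345.
Proof.
move=> d0 dn /andP[x0 x1].
have x1' : 0 <= 1 - x by lra.
have [xd|xd] := leP (1 - x) (2 * d).
  by rewrite (overshoot_mean_eq0 _ xd) add0r; exact: overshoot_mean_le.
have [xd'|xd'] := leP x (2 * d).
  have e : 1 - (1 - x) <= 2 * d by lra.
  by rewrite (overshoot_mean_eq0 _ e) addr0; exact: overshoot_mean_le.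
have := overshoot_mean_le_half d0 dn xd' xd.
have := @overshoot_mean_le_half n d (1 - x) d0 dn xd.
by rewrite opprB addrC subrK => /(_ xd'); lra.
Qed.

Lemma sikkema_ge : 31 / 345 <= sikkema R - 1.
Proof.
have : 218 / 89 <= Num.sqrt 6 :> R.
  rewrite -[leLHS]ger0_norm; last lra.
  by rewrite -sqrtr_sqr ler_wsqrtr//; lra.
rewrite /sikkema; lra.
Qed.

End Overshoot.

(** * The estimate for a fixed outcome *)

Section Deterministic.
Context {R : realType}.
Implicit Types (x d : R) (n k : nat).

Lemma bernstein_basis_sum n x : \sum_(k < n.+1) bernstein_basis k n x = 1.
Proof.
rewrite -[RHS](expr1n R n) -[in RHS](subrK x 1) exprDn.
by apply: eq_bigr => k _; rewrite /bernstein_basis mulrAC -mulrA mulr_natl.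
Qed.

Lemma bernstein_basis_rev n k x : (k <= n)%N ->
  bernstein_basis (n - k) n x = bernstein_basis k n (1 - x).
Proof.
move=> kn; rewrite /bernstein_basis bin_sub// subKn// (_ : 1 - (1 - x) = x); last by ring.
by rewrite mulrAC.
Qed.

Lemma overshoot_mean_rev n d x :
  \sum_(k < n.+1) (overshoot n d (1 - x) (n - k))%:R * bernstein_basis k n x =
  overshoot_mean n d (1 - x).
Proof.
rewrite /overshoot_mean (reindex_inj rev_ord_inj)/=; apply: eq_bigr => k _.
have kn : (k <= n)%N by rewrite -ltnS.
by rewrite subSS (subKn kn) (bernstein_basis_rev _ kn).
Qed.

(** The step count is made with d = 1 / sqrt n, while the displacement of y and the steps have
length delta >= d. *)
Lemma overshootP n d delta x y k : 0 < d -> d ^+ 2 * n%:R = 1 -> d <= delta ->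
  0 <= x -> y <= 1 -> y <= k%:R / n%:R + delta ->
  y - x <= (2 + (overshoot n d x k)%:R) * delta.
Proof.
move=> d0 dn dd x0 y1 yk.
have n0 : 0 < n%:R :> R.
  by rewrite -(pmulr_rgt0 _ (exprn_gt0 2 d0)) dn.
have dE : d * n%:R = d^-1.
  by apply: (mulfI (lt0r_neq0 d0)); rewrite mulrA -expr2 dn mulfV// lt0r_neq0.
rewrite /overshoot.
have [xd|xd] := leP (1 - x) (2 * d); first by rewrite addr0/=; lra.
have p0 : 0 <= n%:R * x + d^-1 by rewrite addr_ge0 ?mulr_ge0 ?invr_ge0 ?(ltW d0).
have [tl _] := andP (truncn_itv p0).
case: ltnP => [|kk] /=.
  rewrite /first_far ltnS => kt; rewrite addr0.
  have kx : k%:R <= n%:R * x + d^-1 by apply: le_trans tl; rewrite ler_nat.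
  have kd : k%:R / n%:R <= x + d by rewrite ler_pdivrMr// mulrDl dE; lra.
  lra.
have [x3|x3] := leP (1 - x) (3 * d); first by lra.
set m := Num.trunc d^-1; set q := (_ %/ m)%N.
have m0 : (0 < m)%N.
  by rewrite /m truncn_gt0 invr_ge1 ?unitfE ?lt0r_neq0//; lra.
have di0 : 0 <= d^-1 by rewrite invr_ge0 ltW.
have [ml _] := andP (truncn_itv di0).
have kq : (k < first_far n d x + q.+1 * m)%N.
  by rewrite -ltn_subLR// ltn_ceil.
have kq' : k%:R <= n%:R * x + d^-1 + q.+1%:R * d^-1.
  move: kq; rewrite /first_far addSn ltnS -(ler_nat R) natrD natrM => /le_trans; apply.
  by apply: lerD => //; apply: ler_wpM2l.
have kn : k%:R / n%:R <= x + d + q.+1%:R * d.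
  by rewrite ler_pdivrMr// !mulrDl -mulrA dE; lra.
have : q.+1%:R * d <= q.+1%:R * delta by apply: ler_wpM2l.
move: yk kn; move: (k%:R / n%:R) (q.+1%:R) => t Q yk kn; clear - yk kn dd.
by rewrite mulrDl; lra.
Qed.

(** The segment from v to u is cut into N equal parts. *)
Lemma modulus_chain (g : R -> R) K delta N :
  (forall u v, 0 <= u <= 1 -> 0 <= v <= 1 -> `|u - v| <= delta -> `|g u - g v| <= K) ->
  forall u v, 0 <= u <= 1 -> 0 <= v <= 1 -> `|u - v| <= N%:R * delta ->
  `|g u - g v| <= N%:R * K.
Proof.
move=> gK; elim: N => [|N IH] u v u01 v01.
  by rewrite !mul0r normr_le0 subr_eq0 => /eqP->; rewrite subrr normr0.
set M : R := N.+1%:R; have M1 : 1 <= M by rewrite ler1n.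
have ME : M = N%:R + 1 by rewrite natr1.
move=> uv; pose w := v + (u - v) * (N%:R / M).
have N0 : 0 <= N%:R :> R by exact: ler0n.
clearbody M; have Mp : 0 < M by exact: lt_le_trans M1.
have t01 : 0 <= N%:R / M <= 1.
  by apply/andP; split; [apply: divr_ge0; lra|rewrite ler_pdivrMr//; lra].
have w01 : 0 <= w <= 1.
  rewrite /w; move: (_ / M) t01 => t t01; apply/andP; split; nra.
have M0 : M != 0 by apply: lt0r_neq0; lra.
have uw : `|u - w| <= delta.
  have -> : u - w = (u - v) / M by rewrite /w ME; field; rewrite -ME.
  by rewrite normrM normfV (gtr0_norm (_ : 0 < M)) ?ler_pdivrMr//; lra.
have wv : `|w - v| <= N%:R * delta.
  have -> : w - v = (u - v) / M * N%:R by rewrite /w; field.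
  rewrite 2!normrM normfV (gtr0_norm (_ : 0 < M)) ?normr_nat; last lra.
  by rewrite mulrC ler_wpM2l// ler_pdivrMr//; lra.
have := IH _ _ w01 v01 wv; have := gK _ _ u01 w01 uw.
have := ler_distD (g w) (g u) (g v).
by rewrite ME; lra.
Qed.

Lemma bernstein_dist_le (g : R -> R) (y : nat -> R) n delta K x :
  (0 < n)%N -> 0 < delta -> 1 / delta ^+ 2 <= n%:R ->
  (forall u v, 0 <= u <= 1 -> 0 <= v <= 1 -> `|u - v| <= delta -> `|g u - g v| <= K) ->
  (forall k, (k <= n)%N -> 0 <= y k <= 1 /\ `|y k - k%:R / n%:R| <= delta) ->
  0 <= x <= 1 ->
  `|\sum_(k < n.+1) g (y k) * bernstein_basis k n x - g x| <= (1 + sikkema R) * K.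
Proof.
move=> n_gt0 e0 en gK yP x01.
have n0 : 0 < n%:R :> R by rewrite ltr0n.
pose d : R := (Num.sqrt n%:R)^-1.
have d0 : 0 < d by rewrite invr_gt0 sqrtr_gt0.
have dn : d ^+ 2 * n%:R = 1 by rewrite exprVn sqr_sqrtr ?mulVf ?lt0r_neq0// ltW.
have de : d <= delta.
  have e2 : 0 < delta ^+ 2 by exact: exprn_gt0.
  rewrite -(@ler_pXn2r _ 2) ?nnegrE ?(ltW d0) ?(ltW e0)// -(ler_pM2r n0) dn mulrC.
  by rewrite -ler_pdivrMr.
have [x0 x1] := andP x01.
have K0 : 0 <= K.
  by have := gK x x x01 x01; rewrite !subrr normr0 => /(_ (ltW e0)).
pose W k : R := (overshoot n d x k)%:R + (overshoot n d (1 - x) (n - k))%:R.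
have gW k : (k <= n)%N -> `|g (y k) - g x| <= (2 + W k) * K.
  move=> kn; have [y01] := yP k kn; rewrite ler_norml => /andP[ya yb].
  have [y0 y1] := andP y01.
  have -> : 2 + W k = (2 + overshoot n d x k + overshoot n d (1 - x) (n - k))%:R.
    by rewrite !natrD addrA.
  apply: (modulus_chain gK) => //.
  rewrite !natrD ler_norml; apply/andP; split.
    have := @overshootP n d delta (1 - x) (1 - y k) (n - k) d0 dn de.
    rewrite natrB// mulrBl divff ?lt0r_neq0// => /(_ ltac:(lra) ltac:(lra) ltac:(lra)).
    have : 0 <= (overshoot n d x k)%:R * delta by rewrite mulr_ge0// ltW.
    lra.
  have := @overshootP n d delta x (y k) k d0 dn de x0 y1 ltac:(lra).
  have : 0 <= (overshoot n d (1 - x) (n - k))%:R * delta by rewrite mulr_ge0// ltW.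
  lra.
have b0 k : 0 <= bernstein_basis k n x by exact: bernstein_basis_ge0.
have -> : \sum_(k < n.+1) g (y k) * bernstein_basis k n x - g x =
    \sum_(k < n.+1) (g (y k) - g x) * bernstein_basis k n x.
  rewrite -[X in _ - X]mulr1 -(bernstein_basis_sum n x) mulr_sumr -sumrB.
  by apply: eq_bigr => k _; rewrite mulrBl.
apply: (le_trans (ler_norm_sum _ _ _)).
apply: (@le_trans _ _ (\sum_(k < n.+1) (2 + W k) * K * bernstein_basis k n x)).
  apply: ler_sum => k _; rewrite normrM (ger0_norm (b0 k)).
  by apply: ler_wpM2r => //; apply: gW; rewrite -ltnS.
have -> : \sum_(k < n.+1) (2 + W k) * K * bernstein_basis k n x =
    (2 + (overshoot_mean n d x + overshoot_mean n d (1 - x))) * K.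
  rewrite -[2 in RHS]mulr1 -[X in 2 * X](bernstein_basis_sum n x).
  rewrite -(overshoot_mean_rev n d x) /overshoot_mean mulr_sumr -!big_split/=.
  by rewrite mulr_suml; apply: eq_bigr => k _; rewrite /W; ring.
apply: ler_wpM2r => //.
have := overshoot_mean_pair_le d0 dn x01; have := @sikkema_ge R.
move: (overshoot_mean n d x + overshoot_mean n d (1 - x)) (sikkema R) => a b.
lra.
Qed.

End Deterministic.

(** * Uniform continuity and measurability *)

Section Regularity.
Context {R : realType}.

Lemma in_itv01 (x : R) : (x \in `[0, 1]) = (0 <= x <= 1).
Proof. by rewrite in_itv. Qed.

(** Heine's theorem with a parameter: the continuity moduli at the points of [0, 1] do not
depend on w, so a finite cover of [0, 1] provides one for all points and all w. *)
Lemma continuous01_unif_equi T (f : R -> T -> R) (eps : R) :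
  continuous01_unif f -> 0 < eps ->
  exists2 delta, 0 < delta < 1 &
    forall w (u v : R), 0 <= u <= 1 -> 0 <= v <= 1 -> `|u - v| <= delta ->
      `|f u w - f v w| <= eps.
Proof.
move=> f_cont eps0.
pose P (delta x : R) := forall w (v : R), 0 <= x <= 1 -> 0 <= v <= 1 ->
  `|x - v| <= delta -> `|f x w - f v w| <= eps.
have nc : near_covering (`[0, 1]%classic : set R).
  exact/compact_near_coveringP/segment_compact.
have : \forall delta \near (0 : R)^'+, (`[0, 1]%classic : set R) `<=` P delta.
  apply: nc => x; rewrite /= in_itv/= => x01.
  have x01' : x \in `[0, 1] by rewrite in_itv01.
  have e2 : 0 < eps / 2 by lra.
  have [e e0 fe] := f_cont x x01' _ e2.
  exists (ball x (e / 2), [set delta : R | delta < e / 2]).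
    split=> /=; first by apply: nbhsx_ballx; rewrite divr_gt0.
    by apply: nbhs_right_lt; rewrite divr_gt0.
  move=> [y delta]/= [xy de] w v y01 v01 yv.
  rewrite /ball/= in xy.
  have h1 := fe w y; have h2 := fe w v.
  rewrite !in_itv01 in h1 h2.
  have xy' : `|y - x| < e by rewrite distrC; apply: (lt_trans xy); lra.
  have vx : `|v - x| < e.
    have := ler_distD y v x; rewrite (distrC v y) (distrC y x); lra.
  have := h1 y01 xy'; have := h2 v01 vx.
  have := ler_distD (f x w) (f y w) (f v w); rewrite (distrC (f x w) (f v w)).
  lra.
move=> H.
have [delta [[/= H1 d0] d1]] : exists delta : R, ((`[0, 1]%classic : set R) `<=` P delta /\ 0 < delta) /\ delta < 1.
  apply: (@filter_ex _ (0 : R)^'+); apply: filterI; first apply: filterI => //.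
    exact: nbhs_right_gt.
  exact: nbhs_right_lt.
exists delta; first by rewrite d0.
move=> w u v u01 v01; by apply: H1 => //=; rewrite in_itv.
Qed.

Lemma measurable_bigmax d (T : measurableType d) n (h : nat -> T -> R) :
  (forall i, (i < n)%N -> measurable_fun setT (h i)) ->
  measurable_fun setT (fun w => \big[Num.max/0]_(i < n) h i w).
Proof.
elim: n h => [h _|n IH h mh].
  rewrite (_ : (fun _ => _) = cst 0); last by apply/funext => w; rewrite big_ord0.
  exact: measurable_cst.
rewrite (_ : (fun w => _) =
    (fun w => Num.max (h 0 w) (\big[Num.max/0]_(i < n) h i.+1 w))).
  apply: measurable_maxr; first exact: mh.
  by apply: (IH (fun i => h i.+1)) => i ik; apply: mh.
by apply/funext => w; rewrite big_ord_recl.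
Qed.

(** The value of Z is rounded down to a multiple of 1 / (m + 1). The rounded substitution is a
finite sum of measurable functions and converges pointwise by continuity. *)
Lemma measurable_random_substitution d (T : measurableType d) (f : R -> T -> R)
    (Z : T -> R) :
  random_function f -> continuous01_unif f -> measurable_fun setT Z ->
  (forall w, 0 <= Z w <= 1) -> measurable_fun setT (fun w => f (Z w) w).
Proof.
move=> f_random f_cont mZ Z01.
pose A m k : set T := [set w | k%:R <= m.+1%:R * Z w < k.+1%:R].
pose h m w := \sum_(k < m.+2) \1_(A m k) w * f (k%:R / m.+1%:R) w.
pose a m w : R := (Num.trunc (m.+1%:R * Z w))%:R / m.+1%:R.
have m0 m : 0 < m.+1%:R :> R by rewrite ltr0n.
have Zp m w : 0 <= m.+1%:R * Z w by rewrite mulr_ge0//; have /andP[] := Z01 w.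
have tlt m w : (Num.trunc (m.+1%:R * Z w) < m.+2)%N.
  rewrite ltnS -(ler_nat R); have /andP[/le_trans + _] := truncn_itv (Zp m w); apply.
  by rewrite ler_piMr//; have /andP[] := Z01 w.
have hE m w : h m w = f (a m w) w.
  rewrite /h (bigD1 (Ordinal (tlt m w)))//= indicE mem_set ?mul1r; last first.
    exact: truncn_itv.
  rewrite big1 ?addr0// => k kt; rewrite indicE memNset ?mul0r// => /= Ak.
  by move/eqP: kt; apply; apply/val_inj => /=; rewrite (truncn_def Ak).
have mA m k : measurable (A m k).
  have mmZ : measurable_fun setT (fun w => m.+1%:R * Z w).
    by apply: measurable_funM => //; exact: measurable_cst.
  have := mmZ measurableT _ (measurable_itv `[k%:R, k.+1%:R[).
  rewrite setTI; congr measurable; apply/seteqP; split => w /=; by rewrite in_itv.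
apply: (@measurable_fun_cvg _ _ _ setT h).
  move=> m; apply: measurable_sum => k; apply: measurable_funM.
    exact: measurable_indic.
  apply: f_random; rewrite in_itv01 divr_ge0//= ler_pdivrMr// mul1r ler_nat.
  by rewrite -ltnS.
move=> w _; have [Z0 Z1] := andP (Z01 w).
apply/cvgrPdist_lt => eps eps0.
have Zw : Z w \in `[0, 1] by rewrite in_itv01 Z01.
have [e e0 fe] := f_cont (Z w) Zw eps eps0.
have : \forall n \near \oo, n.+1%:R^-1 < e.
  exact: near_infty_natSinv_lt (PosNum e0).
apply: filterS => m me /=.
rewrite hE distrC; apply: fe.
  rewrite in_itv01 divr_ge0//= ler_pdivrMr// mul1r ler_nat -ltnS.
  exact: tlt.
have /andP[t1 t2] := truncn_itv (Zp m w).
apply: le_lt_trans me; rewrite ler_norml.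
have {t2} : m.+1%:R * Z w < (Num.trunc (m.+1%:R * Z w))%:R + 1 by rewrite natr1.
move: t1; rewrite /a; move: (Num.trunc _)%:R => t t1 t2.
have -> : t / m.+1%:R - Z w = (t - m.+1%:R * Z w) / m.+1%:R.
  by rewrite mulrBl mulrAC divff ?mul1r// lt0r_neq0.
rewrite ler_pdivrMr// ler_pdivlMr// mulVf ?mulNr ?mulVf ?lt0r_neq0//.
by apply/andP; split; lra.
Qed.

Lemma bernstein_continuous (c : nat -> R) n :
  continuous (fun x : R => \sum_(k < n.+1) c k * bernstein_basis k n x).
Proof.
pose p : {poly R} := \sum_(k < n.+1) (c k * 'C(n, k)%:R) *: ('X ^+ k * (1 - 'X) ^+ (n - k)).
rewrite (_ : (fun x => _) = horner p); first exact: continuous_horner.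
apply/funext => x; rewrite /p horner_sum; apply: eq_bigr => k _.
by rewrite /bernstein_basis !hornerE/= -!mulrA.
Qed.

(** By continuity in x, if the distance exceeds c at some point of [0, 1], then it does so at a
rational one, so the event is a countable union. *)
Lemma measurable_sup_dist01_gt d (T : measurableType d) (g h : R -> T -> R) (c : \bar R) :
  (forall x, 0 <= x <= 1 -> measurable_fun setT (g x)) ->
  (forall x, 0 <= x <= 1 -> measurable_fun setT (h x)) ->
  (forall w x eps, 0 <= x <= 1 -> 0 < eps -> exists2 e, 0 < e &
     forall y, 0 <= y <= 1 -> `|y - x| < e -> `|(g y w - h y w) - (g x w - h x w)| < eps) ->
  measurable [set w | (c < sup_dist01 (fun x => g x w) (fun x => h x w))%E].
Proof.
move=> mg mh cont.
have i0 : 0 <= (0 : R) <= 1 by rewrite lexx ler01.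
case: c => [c| |].
- have -> : [set w | (c%:E < sup_dist01 (g^~ w) (h^~ w))%E] =
      \bigcup_(q : rat) [set w | 0 <= (ratr q : R) <= 1 /\
         c < `|g (ratr q) w - h (ratr q) w|].
    apply/seteqP; split => w /=; last first.
      move=> [q _ [q01 cq]]; apply: (@lt_le_trans _ _ (`|g (ratr q) w - h (ratr q) w|)%:E).
        by rewrite lte_fin.
      by apply: ereal_sup_ubound; exists (ratr q) => //=; rewrite in_itv.
    move=> /ereal_sup_gt[_ [x /= x01 <-]]; rewrite lte_fin in_itv/= in x01 *.
    move=> cx; have [||e e0 he] := cont w x (`|g x w - h x w| - c).
    + exact: x01.
    + lra.
    have [q q01 qx] : exists2 q : rat, 0 <= (ratr q : R) <= 1 & `|ratr q - x| < e.
      have [x0 x1] := andP x01.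
      have [xlt|xge] := ltP x 1.
        have [|q] := @rat_in_itvoo R x (Num.min 1 (x + e)).
          by rewrite lt_min xlt ltrDl.
        rewrite in_itv/= lt_min => /and3P[q1 q2 q3].
        by exists q; [lra|rewrite gtr0_norm; lra].
      exists 1%Q; first by rewrite rmorph1 ler01 lexx.
      by rewrite rmorph1 (_ : x = 1) ?subrr ?normr0//; lra.
    exists q => //; split => //.
    move: (he _ q01 qx) cx.
    move: (g (ratr q) w - _) (g x w - _) => a b ab cb.
    have := lerB_dist b a; rewrite distrC; lra.
  apply: bigcupT_measurable_rat => q.
  have [q01|q01] := boolP (0 <= (ratr q : R) <= 1); last first.
    rewrite [X in measurable X](_ : _ = set0)//.
    by apply/seteqP; split => // w /= [].
  have mgh : measurable_fun setT (fun w => `|g (ratr q) w - h (ratr q) w|).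
    apply: measurableT_comp => //.
    by apply: measurable_funB; [exact: mg|exact: mh].
  have := mgh measurableT _ (measurable_itv `]c, +oo[).
  rewrite setTI; congr measurable; apply/seteqP; split => w /=;
    rewrite in_itv/= andbT; [by split|by case].
- rewrite [X in measurable X](_ : _ = set0)//.
  by apply/seteqP; split => // w /=; rewrite ltNge leey.
- rewrite [X in measurable X](_ : _ = setT)//.
  apply/seteqP; split => // w _ /=; apply: (@lt_le_trans _ _ (`|g 0 w - h 0 w|)%:E).
    exact: ltNyr.
  by apply: ereal_sup_ubound; exists 0 => //=; rewrite in_itv.
Qed.
End Regularity.

(** * Capacities of the deviation events *)

Section Final.
Context {R : realType} {d : measure_display} {T : measurableType d}.
Implicit Types (f : R -> T -> R) (Y : nat -> nat -> T -> R).

Lemma random_array_itv Y n k w : random_array Y -> (0 < n)%N -> (k <= n)%N ->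
  0 <= Y n k w <= 1.
Proof.
move=> YA n0 kn; apply/andP; split.
  elim: k kn => [_|k IH kn]; first exact: random_array_ge0.
  by apply: (le_trans (IH (ltnW kn))); exact: random_array_nondecreasing.
rewrite -(subKn kn); elim: (n - k)%N => [|j IH].
  by rewrite subn0; exact: random_array_le1.
have [jn|nj] := ltnP j n; last first.
  by move: IH; rewrite (eqP nj) (eqP (leqW nj)).
apply: le_trans IH; have -> : (n - j = (n - j.+1).+1)%N by lia.
by apply: random_array_nondecreasing => //; lia.
Qed.

Lemma measurable_bernstein f Y n x : random_function f -> continuous01_unif f ->
  random_array Y -> (0 < n)%N -> measurable_fun setT (bernstein f Y n x).
Proof.
move=> f_random f_cont YA n0.
apply: measurable_sum => k; apply: measurable_funM; last exact: measurable_cst.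
have kn : (k <= n)%N by rewrite -ltnS.
apply: measurable_random_substitution => //.
  exact: random_array_measurable.
by move=> w; exact: random_array_itv.
Qed.

Lemma measurable_max_dev_gt Y n delta : random_array Y -> (0 < n)%N ->
  measurable [set w | delta < max_dev Y n w].
Proof.
move=> YA n0.
have mM : measurable_fun setT (max_dev Y n).
  apply: (@measurable_bigmax _ _ _ n.+1 (fun k w => `|Y n k w - k%:R / n%:R|)).
  move=> k; rewrite ltnS => kn; apply: measurableT_comp => //.
  by apply: measurable_funB => //; exact: random_array_measurable.
have := mM measurableT _ (measurable_itv `]delta, +oo[).
by rewrite setTI; congr measurable; apply/seteqP; split => w /=; rewrite in_itv/= andbT.
Qed.

(** The deterministic estimate at a single outcome; both claims of the theorem follow from it. *)
Lemma bernstein_random_le f Y n delta K x w : random_array Y ->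
  0 < delta -> 1 / delta ^+ 2 <= n%:R ->
  (forall u v, 0 <= u <= 1 -> 0 <= v <= 1 -> `|u - v| <= delta ->
     `|f u w - f v w| <= K) ->
  max_dev Y n w <= delta -> 0 <= x <= 1 ->
  `|bernstein f Y n x w - f x w| <= (1 + sikkema R) * K.
Proof.
move=> YA e0 en fK Mw x01.
have n0 : (0 < n)%N.
  rewrite -(ltr0n R); apply: lt_le_trans en; rewrite divr_gt0// exprn_gt0//.
apply: (bernstein_dist_le (g := f ^~ w) (y := fun k => Y n k w) n0 e0 en) => //.
move=> k kn; split; first exact: random_array_itv.
apply: le_trans Mw.
exact: (@le_bigmax _ _ _ 0 (fun k : 'I_n.+1 => `|Y n k w - k%:R / n%:R|) (Ordinal (kn : (k < n.+1)%N))).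
Qed.

Lemma modulusP f delta K w u v : modulus f delta = K%:E ->
  0 <= u <= 1 -> 0 <= v <= 1 -> `|u - v| <= delta -> `|f u w - f v w| <= K.
Proof.
move=> fK u01 v01 uv; rewrite -lee_fin -fK.
apply: (@le_trans _ _ (ereal_sup [set (`|f xy.1 w - f xy.2 w|)%:E | xy in
      [set xy : R * R | [/\ xy.1 \in `[0, 1], xy.2 \in `[0, 1] &
                            `|xy.1 - xy.2| <= delta]]])).
  by apply: ereal_sup_ubound; exists (u, v) => //=; rewrite !in_itv01.
by apply: ereal_sup_ubound; exists w.
Qed.

Lemma modulus_ge0 f delta (w : T) : 0 <= delta -> (0 <= modulus f delta)%E.
Proof.
move=> d0.
apply: (@le_trans _ _ (ereal_sup [set (`|f xy.1 w - f xy.2 w|)%:E | xy in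
      [set xy : R * R | [/\ xy.1 \in `[0, 1], xy.2 \in `[0, 1] &
                            `|xy.1 - xy.2| <= delta]]])).
  apply: ereal_sup_ubound; exists (0, 0) => /=; last by rewrite subrr normr0.
  by rewrite !in_itv01 subrr normr0 lexx ler01.
by apply: ereal_sup_ubound; exists w.
Qed.

Lemma sikkema_bounds : 0 <= sikkema R <= 2.
Proof.
have s0 := sqrtr_ge0 (6 : R).
have : Num.sqrt 6 <= 3 :> R.
  rewrite -[leRHS]ger0_norm; last lra.
  by rewrite -sqrtr_sqr ler_wsqrtr//; lra.
by rewrite /sikkema; move: (Num.sqrt 6) s0 => s s0 s3; apply/andP; split; lra.
Qed.
End Final.

Theorem theorem5 (R : realType) (d : measure_display) (T : measurableType d)
    (mu : set T -> R) (mu_capacity : capacity mu)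
    (f : R -> T -> R) (f_random : random_function f)
    (f_cont : continuous01_unif f)
    (Y : nat -> nat -> T -> R) (Y_array : random_array Y) :
  ((forall eps : R, 0 < eps ->
      mu [set w | eps < max_dev Y n w] @[n --> \oo] --> (0 : R)) ->
    cvg_in_capacity_unif01 mu (bernstein f Y) f)
  /\
  (forall (delta : R) (n : nat), 0 < delta < 1 -> 1 / delta ^+ 2 <= n%:R ->
    mu [set w | ((1 + sikkema R)%:E * modulus f delta <
                 sup_dist01 (fun x => bernstein f Y n x w)
                            (fun x => f x w))%E]
    <= mu [set w | delta < max_dev Y n w]).
Proof.
have le_mu := le_capacity mu_capacity.
have /andP[s0 s2] := @sikkema_bounds R.
split.
  move=> Mcvg eps eta eps0 eta0.
  (* Since c <= 2, a modulus of at most eps / 4 gives a deviation below eps. *)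
  have eps4 : 0 < eps / 4 by lra.
  have [delta /andP[delta0 delta1] fdelta] := continuous01_unif_equi f_cont eps4.
  have := Mcvg _ delta0 => /cvgrPdist_lt/(_ _ eta0)[N _ NP].
  pose n0 := maxn N (Num.trunc (1 / delta ^+ 2)).+1.
  exists n0 => [|n x n0n x01]; first by rewrite /n0 leq_max orbT.
  have npos : (0 < n)%N by apply: leq_trans n0n; rewrite /n0 leq_max orbT.
  have nd : 1 / delta ^+ 2 <= n%:R.
    apply: ltW; apply: lt_le_trans (truncnS_gt _) _; rewrite ler_nat.
    by apply: leq_trans n0n; rewrite /n0 leq_maxr.
  have Nn : (N <= n)%N by apply: leq_trans n0n; rewrite /n0 leq_maxl.
  have := NP _ Nn; rewrite /= sub0r normrN => /(le_lt_trans (ler_norm _)).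
  apply: le_lt_trans; apply: le_mu.
  - have mg : measurable_fun setT (fun w => `|bernstein f Y n x w - f x w|).
      apply: measurableT_comp => //; apply: measurable_funB; last exact: f_random.
      exact: measurable_bernstein.
    have := mg measurableT _ (measurable_itv `[eps, +oo[).
    by rewrite setTI; congr measurable; apply/seteqP; split => w /=; rewrite in_itv/= andbT.
  - exact: measurable_max_dev_gt.
  - move=> w /= epsw; rewrite ltNge; apply/negP => Mw.
    rewrite in_itv01 in x01.
    have := @bernstein_random_le _ _ _ f Y n delta (eps / 4) x w Y_array delta0 nd (fdelta w) Mw x01.
    apply/negP; rewrite -ltNge; apply: lt_le_trans epsw.
    nra.
move=> delta n /andP[delta0 delta1] nd.
have npos : (0 < n)%N.
  by rewrite -(ltr0n R); apply: lt_le_trans nd; rewrite divr_gt0// exprn_gt0.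
apply: le_mu.
- apply: measurable_sup_dist01_gt.
  + by move=> x _; exact: measurable_bernstein.
  + by move=> x x01; apply: f_random; rewrite in_itv01.
  + move=> w x eps x01 eps0.
    have e2 : 0 < eps / 2 by lra.
    have x01' : x \in `[0, 1] by rewrite in_itv01.
    have [e1 e10 fe1] := f_cont x x01' _ e2.
    have := @bernstein_continuous R (fun k => f (Y n k w) w) n x.
    move=> /cvgrPdist_lt/(_ _ e2) /nbhs_ballP[e3 /= e30 be3].
    exists (Num.min e1 e3); first by rewrite lt_min e10.
    move=> y y01; rewrite lt_min => /andP[y1 y3].
    have h1 := fe1 w y; rewrite in_itv01 in h1; have {}h1 := h1 y01 y1.
    have h2 : `|bernstein f Y n x w - bernstein f Y n y w| < eps / 2.
      by apply: be3; rewrite /ball/= distrC.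
    move: h1 h2; move: (f y w) (f x w) (bernstein f Y n y w) (bernstein f Y n x w) => a b p q h1 h2.
    have -> : p - a - (q - b) = (p - q) - (a - b) by ring.
    by apply: le_lt_trans (ler_normB _ _) _; rewrite (distrC p); lra.
- exact: measurable_max_dev_gt.
- move=> w /= cw; rewrite ltNge; apply/negP => Mw.
  move: cw; apply/negP; rewrite -leNgt; apply: ge_ereal_sup => _ [x /= x01 <-].
  have := modulus_ge0 f w (ltW delta0).
  case fK : (modulus f delta) => [K| |] // _.
    rewrite -EFinM lee_fin.
    apply: (bernstein_random_le Y_array delta0 nd _ Mw).
      by move=> u v; exact: modulusP.
    by move: x01; rewrite in_itv.
  by rewrite gt0_muley ?leey// lte_fin; lra.
Qed.
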